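(* Let $\Gamma$ be a strongly connected regular digraph all of whose eigenvalues are real and whose adjacency matrix is not diagonalizable. Then $\Gamma$ is strongly $\ell$-walk-regular for at most two values of $\ell>1$, and these values of $\ell$ are odd.
   Context: All digraphs are finite and simple: a digraph is a pair $(V,E)$ with $V$ a finite nonempty set of vertices and $E$ a set of ordered pairs of distinct vertices (no loops, no multiple edges; both $uv$ and $vu$ may be edges). A vertex $u$ is adjacent to $v$ if $uv\in E$. The adjacency matrix $A$ has $A_{uv}=1$ if $u$ is adjacent to $v$ and $0$ otherwise; eigenvalues of $\Gamma$ are the (complex) eigenvalues of $A$. $\Gamma$ is regular of degree $k$ if all vertices have both indegree and outdegree $k$. $\Gamma$ is strongly connected if there is a walk from every vertex to every other vertex. For an integer $\ell>1$, $\Gamma$ is strongly $\ell$-walk-regular if there are numbers $\lambda_\ell,\mu_\ell,\nu_\ell$ such that the number of walks of length $\ell$ from $u$ to $v$ (that is, $(A^\ell)_{uv}$) equals $\lambda_\ell$ whenever $u$ is adjacent to $v$, $\mu_\ell$ whenever $u\neq v$ and $u$ is not adjacent to $v$, and $\nu_\ell$ whenever $u=v$. *)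

(* Defs.v *)
From HB Require Import structures.
From mathcomp Require Import all_boot all_order all_algebra.
From mathcomp Require Import reals complex.

Set Implicit Arguments.
Unset Strict Implicit.
Unset Printing Implicit Defensive.

Import Order.TTheory GRing.Theory Num.Theory.

Record digraph := Digraph {
  vertex :> finType;
  arc : rel vertex;
  arc_irreflexive : irreflexive arc;
  vertex_nonempty : (0 < #|vertex|)%N
}.

Definition regular_of_degree (G : digraph) (k : nat) : Prop :=
  forall u : G,
    #|[set v : G | arc u v]| = k /\ #|[set v : G | arc v u]| = k.

Definition regular (G : digraph) : Prop :=
  exists k : nat, regular_of_degree G k.

Definition strongly_connected (G : digraph) : Prop :=
  forall u v : G, connect (@arc G) u v.

(* A walk u = w_0, w_1, ..., w_l = v is encoded by its start u and the l-tuple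
   (w_1, ..., w_l). *)
Definition nwalks (G : digraph) (l : nat) (u v : G) : nat :=
  #|[set w : l.-tuple G | path (@arc G) u w && (last u w == v)]|.

Definition strongly_walk_regular (G : digraph) (l : nat) : Prop :=
  exists lambda mu nu : nat, forall u v : G,
    [/\ arc u v -> nwalks l u v = lambda,
        u != v -> ~~ arc u v -> nwalks l u v = mu
      & u = v -> nwalks l u v = nu].

(* Rows and columns follow the enumeration of the vertices given by enum_val;
   entries are taken in R[i], i.e. in the complex numbers. *)
Definition adjacency_matrix (R : realType) (G : digraph) : 'M[R[i]]_#|G| :=
  (\matrix_(i, j) (arc (enum_val i) (enum_val j))%:R)%R.

(* Main.v *)
Require Import Defs.
From mathcomp Require Import all_boot all_order all_algebra all_field.
From mathcomp Require boolp.
From mathcomp Require Import reals complex ring lra zify.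

(** Let [k] be the degree. Connectivity makes the eigenvalue [k] simple, so some
    eigenvalue [a <> k] is not semisimple. The trace of [A] is zero and [a] is an
    algebraic integer, so [k] and [a] cannot be the only eigenvalues: there is a
    third one, [b]. If the digraph is strongly l-walk-regular then
    [A ^ l = c A + d I + e J], hence [x ^ l - c x - d] has [a] as a double root
    and [b] as a root; eliminating [c] and [d] shows that [s = b / a] is a root,
    other than 1, of [x ^ l - l x + (l - 1)]. For [s] real this forces [s < 0]
    and [l] odd, and determines [l]. *)

Set Implicit Arguments.
Unset Strict Implicit.
Unset Printing Implicit Defensive.

Import Order.TTheory GRing.Theory Num.Theory.
Local Open Scope ring_scope.

(* [path.arc] shadows the arc relation of digraphs. *)
Local Notation arc := Defs.arc.

(** * Generalized eigenvectors, traces and rational eigenvalues of matrices *)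

Lemma not_uniq_perm (T : eqType) (s : seq T) :
  ~~ uniq s -> exists x r, perm_eq s [:: x, x & r].
Proof.
elim: s => [//|x s IHs] /=; rewrite negb_and negbK => /orP[xs|/IHs[y [r sr]]].
  by exists x, (rem x s); rewrite perm_cons perm_to_rem.
exists y, (x :: r); apply: perm_trans (_ : perm_eq [:: x, y, y & r] _).
  by rewrite perm_cons.
by rewrite (perm_catCA [:: x] [:: y; y] r).
Qed.

(** The minimal polynomial has a repeated root, so it factors as [q (X - a)^2]. By minimality
    [q (X - a)] does not annihilate [A], and a suitable combination of the rows of [q(A)] serves as
    [v]. *)
Lemma nondiagonalizable_genvec (F : closedFieldType) n (A : 'M[F]_n) :
    ~ diagonalizable A ->
  exists a (v : 'rV_n), v *m (A - a%:M) != 0 /\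
    v *m (A - a%:M) *m (A - a%:M) = 0.
Proof.
case: n A => [A []|n A nd].
  by exists 1%:M; [exact: unitmx1 | apply/is_diag_mxP; case].
have [rs def_p] := closed_field_poly_normal (mxminpoly A).
rewrite (monicP (mxminpoly_monic A)) scale1r in def_p.
have /not_uniq_perm[a [r rsP]] : ~~ uniq rs.
  by apply/negP => urs; apply/nd/diagonalizableP; exists rs; rewrite // def_p.
rewrite (perm_big _ rsP) !big_cons /= in def_p; set q := \prod_(j <- r) _ in def_p.
have hXa : horner_mx A ('X - a%:P) = A - a%:M.
  by rewrite rmorphB /= horner_mx_X horner_mx_C.
have {}def_p : mxminpoly A = q * ('X - a%:P) * ('X - a%:P).
  by rewrite def_p mulrA mulrC mulrA.
have q1 : q * ('X - a%:P) \is monic by rewrite monicMl ?monicXsubC ?monic_prod_XsubC.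
have: horner_mx A (q * ('X - a%:P)) != 0.
  apply/eqP => /mxminpoly_min /(dvdp_leq (monic_neq0 q1)).
  rewrite def_p [X in (X <= _)%N]size_Mmonic ?monic_neq0 ?monicXsubC //.
  by rewrite size_XsubC addn2 /= ltnn.
rewrite rmorphM /= hXa -[_ * _]/(_ *m _) => /rowV0Pn[w /submxP[D ->] Dw].
exists a, (D *m horner_mx A q); split; first by rewrite -mulmxA.
rewrite -!mulmxA; have := mx_root_minpoly A.
rewrite def_p !rmorphM /= hXa -![_ * _]/(_ *m _) -mulmxA => ->; exact: mulmx0.
Qed.

(** The characteristic polynomial is [(X - a)^n]; its subleading coefficient is minus the trace. *)
Lemma trace_unique_eigenvalue (F : closedFieldType) n (A : 'M[F]_n) a :
  (forall b, eigenvalue A b -> b = a) -> \tr A = n%:R * a.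
Proof.
case: n A => [A _|n A eigA]; first by rewrite /mxtrace big_ord0 mul0r.
have [rs def_p] := closed_field_poly_normal (char_poly A).
rewrite (monicP (char_poly_monic A)) scale1r in def_p.
have size_rs : size rs = n.+1.
  by apply: succn_inj; rewrite -(size_prod_XsubC _ id) -def_p size_char_poly.
have rs_a : all (pred1 a) rs.
  apply/allP => b b_rs; apply/eqP/eigA; rewrite eigenvalue_root_char def_p.
  by rewrite root_prod_XsubC.
apply: oppr_inj; rewrite -(char_poly_trace A (ltn0Sn n)) def_p -[in LHS]size_rs.
rewrite coefPn_prod_XsubC ?size_rs; congr (- _).
rewrite -size_rs; elim: rs rs_a {def_p size_rs} => [|b rs IH] /=.
  by rewrite big_nil mul0r.
by case/andP=> /eqP-> /IH e; rewrite big_cons e -addn1 natrD mulrDl mul1r addrC.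
Qed.

(** The characteristic polynomial is monic over the integers, so [q] is a rational algebraic
    integer. The root is carried through the rationals into [algC], where [Aint] lives. *)
Lemma rational_eigenvalue_int (F : numFieldType) n (M : 'M[int]_n) (q : rat) :
  eigenvalue (map_mx intr M : 'M[F]_n) (ratr q) -> q \is a Num.int.
Proof.
have intr_ratr (K : numFieldType) (p : {poly int}) :
    map_poly intr p = map_poly (@ratr K) (map_poly intr p).
  by rewrite -map_poly_comp /=; apply: eq_map_poly => z /=; rewrite ratr_int.
rewrite eigenvalue_root_char -map_char_poly intr_ratr fmorph_root => rq.
have rqC : root (map_poly (intr : int -> algC) (char_poly M)) (ratr q).
  by rewrite intr_ratr fmorph_root.
have Aq : ratr q \in Aint.
  apply: (root_monic_Aint rqC); first by rewrite monic_map ?char_poly_monic.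
  by apply/polyOverP => i; rewrite coef_map /= intr_int.
have := Cint_rat_Aint (Crat_rat q) Aq.
by case/intrP => z; rewrite -[z%:~R](ratr_int algC) => /fmorph_inj ->; rewrite intr_int.
Qed.

(** * Real roots of the tangent polynomial *)

Section TangentPolynomial.
Variable R : realDomainType.
Implicit Types (s t : R) (l m : nat).

(* The exponent is [l + 1], so that no truncated predecessor occurs. *)
Definition tangent_poly s l : R := s ^+ l.+1 - l.+1%:R * s + l%:R.

(** This is the height of the convex curve [s ^ (l + 1)] above its tangent line at 1. The recursion
    [rec] keeps it positive. *)
Lemma tangent_poly_gt0 s l : 0 <= s -> s != 1 -> (0 < l)%N -> 0 < tangent_poly s l.
Proof.
move=> s0 s1; have sq_gt0 : 0 < (s - 1) ^+ 2.
  by rewrite lt_def sqr_ge0 expf_neq0 ?subr_eq0.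
have rec m : tangent_poly s m.+1 = s * tangent_poly s m + m.+1%:R * (s - 1) ^+ 2.
  by rewrite /tangent_poly [s ^+ m.+2]exprS -addn2 -[m.+1]addn1 !natrD; ring.
case: l => // l _; elim: l => [|l IHl]; rewrite rec.
  by rewrite /tangent_poly expr1; nra.
by apply: ltr_wpDl; [exact/mulr_ge0/ltW/IHl | rewrite mulr_gt0 ?ltr0n].
Qed.

Lemma tangent_poly_root s l : s != 1 -> (0 < l)%N -> tangent_poly s l = 0 ->
  s < 0 /\ ~~ odd l.
Proof.
move=> s1 l0 root_s; have s_lt0 : s < 0.
  rewrite ltNge; apply/negP => s0.
  by have := tangent_poly_gt0 s0 s1 l0; rewrite root_s ltxx.
(* For [l] odd and [s < 0], all three terms would be nonnegative and the first two positive. *)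
split=> //; apply/negP => odd_l.
have : 0 < s ^+ l.+1 by rewrite exprn_even_gt0 //= ?odd_l // lt_eqF.
have : 0 < l.+1%:R * - s by rewrite mulr_gt0 ?ltr0n ?oppr_gt0.
have : (0 : R) <= l%:R by rewrite ler0n.
by move: root_s; rewrite /tangent_poly; lra.
Qed.

(* In terms of t = - s > 0 the equation reads g l = 0 where
   g j = t ^ (j + 1) - (j + 1) t - j is convex in j and g 0 = 0. *)
Lemma tangent_poly_root_lt s l m : s != 1 -> (0 < l)%N -> (l < m)%N ->
  tangent_poly s l = 0 -> tangent_poly s m <> 0.
Proof.
move=> s1 l0 lm rl rm.
have [s0 ol] := tangent_poly_root s1 l0 rl.
have [_ om] := tangent_poly_root s1 (ltn_trans l0 lm) rm.
pose t := - s; have t0 : 0 < t by rewrite oppr_gt0.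
pose g j := t ^+ j.+1 - j.+1%:R * t - j%:R.
have gE j : ~~ odd j -> g j = - tangent_poly s j.
  by rewrite /g /tangent_poly /t => oj; rewrite exprNn -signr_odd /= oj expr1; ring.
have g0 : g 0%N = 0 by rewrite /g expr1; ring.
have gl : g l = 0 by rewrite gE // rl oppr0.
have gm : g m = 0 by rewrite gE // rm oppr0.
pose D j := t ^+ j.+1 * (t - 1) - t - 1.
have gD j : g j.+1 = g j + D j.
  by rewrite /g /D [t ^+ j.+2]exprS -addn2 -[j.+1]addn1 !natrD; ring.
(* The equation [g l = 0] reads [t ^ (l + 1) = (l + 1) t + l], which exceeds 1 since [l >= 1]. *)
have t1 : 1 < t.
  rewrite ltNge; apply/negP => t1; have : t ^+ l.+1 <= 1 by rewrite exprn_ile1 // ltW.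
  case: l l0 gl {lm rl ol} => // l _; rewrite /g -addn2 -addn1 !natrD => gl le1.
  have /(mulr_ge0 (ltW t0)) : (0 : R) <= l%:R by rewrite ler0n.
  have : (0 : R) <= l%:R by rewrite ler0n.
  by move: gl; nra.
have D_lt i j : (i < j)%N -> D i < D j.
  move=> ij; rewrite /D !ltrD2r ltr_pM2r ?subr_gt0 //.
  by rewrite ltr_eXn2l.
(* The increments [D] of [g] increase because [t > 1]. If the one leading to [l] is positive, [g]
   stays positive after [l], against [g m = 0]. Otherwise [g] decreases strictly from 0 before
   reaching [l] and cannot return to 0 there. *)
case: (ltrP 0 (D l.-1)) => [Dpos|Dneg].
  have gpos i : 0 < g (l + i.+1)%N.
    elim: i => [|i IHi]; rewrite addnS gD.
      by rewrite addn0 gl add0r (lt_trans Dpos) // D_lt // prednK.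
    rewrite addr_gt0 // (lt_trans Dpos) // D_lt //; lia.
  have := gpos (m - l.+1)%N; have -> : (l + (m - l.+1).+1 = m)%N by lia.
  by rewrite gm ltxx.
have gneg i : (i < l)%N -> g i.+1 < 0 \/ i.+1 = l.
  elim: i => [|i IHi] il; rewrite gD.
    have [->|?] := eqVneq 1%N l; [by right|left].
    rewrite g0 add0r (lt_le_trans _ Dneg) // D_lt //; lia.
  have [->|?] := eqVneq i.+2 l; [by right|left].
  case: (IHi _) => [|gi|]; [lia| |lia].
  by rewrite (lt_trans _ gi) // gtrDl (lt_le_trans _ Dneg) // D_lt //; lia.
(* Parity excludes [l = 1], so [g] has an earlier strictly negative value at [l - 1]. *)
case: l l0 lm rl ol gl Dneg gneg => [//|[|l]] _ lm rl ol gl Dneg gneg //.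
case: (gneg l _) => // [gl1|]; last lia.
by move: gl; rewrite gD /= in Dneg *; lra.
Qed.

Lemma tangent_poly_root_uniq s l m : s != 1 -> (0 < l)%N -> (0 < m)%N ->
  tangent_poly s l = 0 -> tangent_poly s m = 0 -> l = m.
Proof.
move=> s1 l0 m0 rl rm; case: (ltngtP l m) => // lm.
  by case: (tangent_poly_root_lt s1 l0 lm rl).
by case: (tangent_poly_root_lt s1 m0 lm rm).
Qed.

End TangentPolynomial.

(** * Walk counts as entries of powers of the adjacency matrix *)

Lemma nwalks0 (G : digraph) (u v : G) : nwalks 0 u v = (u == v).
Proof.
rewrite /nwalks; case: eqVneq => uv.
  by apply: (@eq_card1 _ [tuple]) => w; rewrite !inE [w]tuple0 /= uv !eqxx.
by apply: eq_card0 => w; rewrite !inE [w]tuple0 /= (negPf uv).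
Qed.

Lemma nwalksS (G : digraph) l (u v : G) :
  nwalks l.+1 u v = (\sum_w arc u w * nwalks l w v)%N.
Proof.
rewrite /nwalks -sum1_card.
under [RHS]eq_bigr => w _ do rewrite -sum1_card big_distrr big_mkcond /=.
rewrite pair_bigA /= (reindex (fun p : G * l.-tuple G => cons_tuple p.1 p.2)) /=.
  rewrite big_mkcond; apply: eq_bigr => -[w t] _ /=; rewrite !inE /=.
  by case: (arc u w); case: ifP.
exists (fun t : l.+1.-tuple G => (thead t, behead_tuple t)) => [[w t] _|t _].
  by rewrite theadE; congr (_, _); apply: val_inj.
by apply: val_inj; rewrite [in RHS](tuple_eta t).
Qed.

Section Adjacency.
Variables (R : realType) (G : digraph).
Local Notation A := (adjacency_matrix R G).
Local Notation n := #|G|.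
Local Notation J := (const_mx 1 : 'M[R[i]]_n).
Local Notation ev := (@enum_val G predT).

Lemma adjacency_matrixX l i j : (A ^+ l) i j = (nwalks l (ev i) (ev j))%:R.
Proof.
elim: l i j => [|l IHl] i j.
  by rewrite expr0 !mxE nwalks0 (inj_eq enum_val_inj).
rewrite exprS -[_ * _]/(_ *m _) mxE nwalksS natr_sum.
rewrite (reindex_onto ev enum_rank) => [|w _]; last by rewrite enum_rankK.
apply: eq_big => [w|w _]; first by rewrite enum_valK eqxx.
by rewrite mxE IHl natrM.
Qed.

Lemma adjacency_matrix_trace : \tr A = 0.
Proof. by rewrite /mxtrace big1 // => i _; rewrite mxE arc_irreflexive. Qed.

Lemma walk_regular_adjacency_matrixX l : strongly_walk_regular G l ->
  exists a b c, A ^+ l = a *: A + b%:M + c *: J.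
Proof.
move=> [la [mu [nu swr]]]; exists (la%:R - mu%:R), (nu%:R - mu%:R), mu%:R.
apply/matrixP => i j; rewrite adjacency_matrixX !mxE.
have [ha hm hn] := swr (ev i) (ev j).
have [ij|ij] := eqVneq i j.
  by rewrite ij in hn *; rewrite hn // arc_irreflexive /=; ring.
have [aij|aij] := boolP (arc _ _); first by rewrite ha //=; ring.
by rewrite hm ?(inj_eq enum_val_inj) //=; ring.
Qed.

(** * Spectrum of a strongly connected regular digraph *)

Variable k : nat.
Hypotheses (Gk : regular_of_degree G k) (Gconn : strongly_connected G).

Lemma sum_enum_val (P : pred G) :
  \sum_(j < n) (P (ev j))%:R = #|[set v | P v]|%:R :> R[i].
Proof.
rewrite -[#|[set v | P v]|]sum1_card natr_sum [RHS]big_mkcond /=.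
rewrite [RHS](reindex_onto ev enum_rank) => [|w _]; last by rewrite enum_rankK.
apply: eq_big => [w|w _]; first by rewrite enum_valK eqxx.
by rewrite inE; case: ifP.
Qed.

Lemma sum_arc_out i : \sum_j (arc (ev i) (ev j))%:R = k%:R :> R[i].
Proof. by rewrite sum_enum_val (proj1 (Gk _)). Qed.

Lemma sum_arc_in j : \sum_i (arc (ev i) (ev j))%:R = k%:R :> R[i].
Proof. by rewrite (sum_enum_val (fun w => arc w (ev j))) (proj2 (Gk _)). Qed.

Lemma adjacency_mulmxJ : A *m J = k%:R *: J.
Proof.
apply/matrixP => i j; rewrite !mxE mulr1 -(sum_arc_out i).
by apply: eq_bigr => w _; rewrite !mxE mulr1.
Qed.

(* For [v A = k v], the sum of [|v_i - v_j|^2] over the arcs [ij] equals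
   [k |v|^2 + k |v|^2 - 2 k |v|^2 = 0]. *)
Lemma degree_eigenvector_const (v : 'rV[R[i]]_n) :
  v *m A = k%:R *: v -> forall i j, v 0 i = v 0 j.
Proof.
move=> vA.
have vAj j : \sum_i v 0 i * (arc (ev i) (ev j))%:R = k%:R * v 0 j.
  have /rowP/(_ j) := vA; rewrite !mxE => <-.
  by apply: eq_bigr => i _; rewrite mxE.
pose N := \sum_i `|v 0 i| ^+ 2.
have S1 : \sum_i \sum_j (arc (ev i) (ev j))%:R * `|v 0 i| ^+ 2 = k%:R * N.
  rewrite mulr_sumr; apply: eq_bigr => i _; rewrite -mulr_suml; congr (_ * _).
  exact: sum_arc_out.
have S2 : \sum_i \sum_j (arc (ev i) (ev j))%:R * `|v 0 j| ^+ 2 = k%:R * N.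
  rewrite exchange_big mulr_sumr; apply: eq_bigr => i _; rewrite -mulr_suml.
  by congr (_ * _); exact: sum_arc_in.
have S3 : \sum_i \sum_j (arc (ev i) (ev j))%:R * (v 0 i * (v 0 j)^*) = k%:R * N.
  rewrite exchange_big mulr_sumr; apply: eq_bigr => j _ /=.
  rewrite normCK mulrA -vAj mulr_suml; apply: eq_bigr => i _.
  by rewrite mulrCA mulrA.
(* The left side is the conjugate of the one in [S3], whose value is real. *)
have S4 : \sum_i \sum_j (arc (ev i) (ev j))%:R * ((v 0 i)^* * v 0 j) = k%:R * N.
  have NR : (k%:R * N)^* = k%:R * N.
    rewrite rmorphM /= conjC_nat; congr (_ * _); apply/CrealP.
    by rewrite rpred_sum // => i _; rewrite rpredX // normr_real.
  rewrite -NR -S3 rmorph_sum /=; apply: eq_bigr => i _; rewrite rmorph_sum /=.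
  by apply: eq_bigr => j _; rewrite !rmorphM /= conjCK conjC_nat.
have S : \sum_i \sum_j (arc (ev i) (ev j))%:R * `|v 0 i - v 0 j| ^+ 2 = 0.
  transitivity (k%:R * N + k%:R * N - k%:R * N - k%:R * N); last by ring.
  rewrite -{1}S1 -{1}S2 -{1}S3 -S4 -!sumrN -!big_split; apply: eq_bigr => i _ /=.
  rewrite -!sumrN -!big_split; apply: eq_bigr => j _ /=.
  by rewrite !normCK rmorphB /=; ring.
(* A vanishing sum of nonnegative terms vanishes termwise; strong connectivity then propagates the
   equality along paths. *)
have vE i j : arc (ev i) (ev j) -> v 0 i = v 0 j.
  move=> ij; have ge0 i' j' :
      0 <= (arc (ev i') (ev j'))%:R * `|v 0 i' - v 0 j'| ^+ 2.
    by rewrite mulr_ge0 ?ler0n ?exprn_ge0.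
  have Si := psumr_eq0P (fun i' _ => sumr_ge0 _ (fun j' _ => ge0 i' j')) S.
  have /(_ j isT)/eqP := psumr_eq0P (fun j' _ => ge0 i j') (Si i isT).
  by rewrite ij mul1r expf_eq0 normr_eq0 subr_eq0 => /eqP.
move=> i0 j0; rewrite -[i0]enum_valK -[j0]enum_valK.
have /connectP[p] := Gconn (ev i0) (ev j0); move: (ev i0) (ev j0) => x y.
elim: p x => [x _ -> //|z p IHp x /= /andP[xz pz] ey].
by rewrite -(IHp z pz ey); apply: vE; rewrite !enum_rankK.
Qed.

(** Since [(A - a) J = (k - a) J], multiplying the hypothesis by [J] gives [(k - a)^2 v J = 0]. *)
Lemma genvec_orthogonal a (v : 'rV[R[i]]_n) :
  a != k%:R -> v *m (A - a%:M) *m (A - a%:M) = 0 -> v *m J = 0.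
Proof.
move=> ak v0; have AJ : (A - a%:M) *m J = (k%:R - a) *: J.
  by rewrite mulmxBl adjacency_mulmxJ mul_scalar_mx scalerBl.
have := congr1 (mulmx^~ J) v0; rewrite mul0mx -!mulmxA AJ -!scalemxAr AJ.
rewrite -scalemxAr; move=> /eqP; rewrite !scaler_eq0 subr_eq0 eq_sym (negPf ak).
by move=> /eqP.
Qed.

Lemma eigenvector_orthogonal a (v : 'rV[R[i]]_n) :
  a != k%:R -> v *m A = a *: v -> v *m J = 0.
Proof.
move=> ak vA; apply: (genvec_orthogonal ak).
by rewrite [v *m _]mulmxBr vA mul_mx_scalar subrr mul0mx.
Qed.

Lemma mul_rVJ_eq0 (v : 'rV[R[i]]_n) : v *m A = k%:R *: v -> v *m J = 0 -> v = 0.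
Proof.
move=> /degree_eigenvector_const vc vJ; apply/rowP => i; rewrite mxE.
have /rowP/(_ i) := vJ; rewrite !mxE.
under eq_bigr => j _ do rewrite mxE mulr1 (vc j i).
rewrite sumr_const card_ord => /eqP; rewrite mulrn_eq0.
by rewrite eqn0Ngt vertex_nonempty => /eqP.
Qed.

(** The vector [v (A - k)] is fixed up to the factor [k] by [A], hence constant, and is killed by
    [J] because [(A - k) J = 0]. So [k] has no nontrivial Jordan block. *)
Lemma degree_genvec (v : 'rV[R[i]]_n) :
  v *m (A - k%:R%:M) *m (A - k%:R%:M) = 0 -> v *m (A - k%:R%:M) = 0.
Proof.
move=> v0; apply: mul_rVJ_eq0.
  by apply/eqP; rewrite -subr_eq0 -mul_mx_scalar -mulmxBr v0.
by rewrite -mulmxA mulmxBl adjacency_mulmxJ mul_scalar_mx subrr mulmx0.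
Qed.

(* If the only eigenvalues are [k] and [a], then [A - (k - a)/n J] has the only
   eigenvalue [a]. *)
Lemma two_eigenvalues_trace a : a != k%:R ->
  (forall b, eigenvalue A b -> b = k%:R \/ b = a) -> n.-1%:R * a = - k%:R.
Proof.
move=> ak eigA; have n0 : n%:R != 0 :> R[i] by rewrite pnatr_eq0 -lt0n vertex_nonempty.
(* Chosen so that [(A - c J) J = a J], which moves the eigenvalue [k] to [a]. *)
pose c : R[i] := (k%:R - a) / n%:R.
have JJ : J *m J = n%:R *: J.
  apply/matrixP => i j; rewrite !mxE mulr1 -[n in RHS]card_ord -sumr_const.
  by apply: eq_bigr => w _; rewrite !mxE mulr1.
have /trace_unique_eigenvalue : forall b, eigenvalue (A - c *: J) b -> b = a.
  move=> b /eigenvalueP[v vb v0].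
  have vJ : a *: (v *m J) = b *: (v *m J).
    have := congr1 (mulmx^~ J) vb; rewrite -scalemxAl => <-.
    rewrite mulmxBr mulmxBl -!mulmxA adjacency_mulmxJ -scalemxAr -scalemxAl JJ.
    by rewrite scalerA divfK // -!scalemxAr -scalerBl subKr.
  have [->//|ab] := eqVneq b a.
  have {}vJ : v *m J = 0.
    move/eqP: vJ; rewrite -subr_eq0 -scalerBl scaler_eq0 subr_eq0 eq_sym.
    by rewrite (negPf ab) => /eqP.
  have vA : v *m A = b *: v.
    by rewrite -vb mulmxBr -scalemxAr vJ scaler0 subr0.
  have [bk|//] : b = k%:R \/ b = a by apply: eigA; apply/eigenvalueP; exists v.
  by move: v0; rewrite (mul_rVJ_eq0 _ vJ) ?eqxx // -bk.
have trJ : \tr J = n%:R.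
  by rewrite /mxtrace -[n in RHS]card_ord -sumr_const; apply: eq_bigr => i _; rewrite mxE.
rewrite linearB linearZ /= adjacency_matrix_trace trJ divfK // => tr.
have : n%:R = n.-1%:R + 1 :> R[i] by rewrite -{1}(prednK (vertex_nonempty G)) -addn1 natrD.
move=> nE; rewrite nE in tr.
by transitivity ((n.-1%:R + 1) * a - a); [ring | rewrite -tr; ring].
Qed.

Lemma degree_lt : (k < n)%N.
Proof.
have /card_gt0P[u _] := vertex_nonempty G.
rewrite -(proj1 (Gk u)) -[n]cardsT; apply: proper_card; apply/properP.
by split; [exact: subsetT | exists u; rewrite ?inE ?arc_irreflexive].
Qed.

Lemma degree0_adjacency : k = 0%N -> A = 0.
Proof.
move=> k0; apply/matrixP => i j; rewrite !mxE.
have /eqP := proj1 (Gk (ev i)); rewrite k0 cards_eq0 => /eqP/setP/(_ (ev j)).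
by rewrite !inE => ->.
Qed.

Lemma degree_max_adjacency : k = n.-1 -> A = J - 1%:M.
Proof.
move=> kn; apply/matrixP => i j; rewrite !mxE.
have [->|ij] := eqVneq i j; first by rewrite arc_irreflexive subrr.
have /subset_leqif_cards[_] : [set v | arc (ev i) v] \subset ~: [set ev i].
  by apply/subsetP => v; rewrite !inE; apply: contraTneq => ->; rewrite arc_irreflexive.
rewrite (proj1 (Gk (ev i))) cardsC1 -kn eqxx => /esym/eqP/setP/(_ (ev j)).
by rewrite !inE (inj_eq enum_val_inj) eq_sym ij => ->; rewrite subr0.
Qed.

(* Otherwise [a = - k / (n - 1)], which lies in [[-1, 0]] and is an integer:
   so [a = 0] and [A = 0], or [a = -1] and [A = J - I]. *)
Lemma third_eigenvalue a (v : 'rV[R[i]]_n) : a != k%:R ->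
    v *m (A - a%:M) != 0 -> v *m (A - a%:M) *m (A - a%:M) = 0 ->
  exists b, [/\ eigenvalue A b, b != a & b != k%:R].
Proof.
move=> ak vA vAA; have [rs def_p] := closed_field_poly_normal (char_poly A).
rewrite (monicP (char_poly_monic A)) scale1r in def_p.
have eigE b : eigenvalue A b = (b \in rs).
  by rewrite eigenvalue_root_char def_p root_prod_XsubC.
case: (boolP (has (fun b => (b != a) && (b != k%:R)) rs)) => [/hasP[b]|/hasPn eig2].
  by rewrite -eigE => eb /andP[ba bk]; exists b.
have /(two_eigenvalues_trace ak) tr b : eigenvalue A b -> b = k%:R \/ b = a.
  rewrite eigE => /eig2; rewrite negb_and !negbK => /orP[]/eqP->; by [right|left].
have vJ := genvec_orthogonal ak vAA.
have eigA : eigenvalue A a.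
  apply/eigenvalueP; exists (v *m (A - a%:M)) => //.
  by apply/eqP; rewrite -subr_eq0 -mul_mx_scalar -mulmxBr vAA.
(* An eigenvector [v] would satisfy [(c - a)^2 v = 0], hence [v (A - a) = 0]. This rules out
   [k = 0], where [A = 0], and [k = n - 1], where [v J = 0] gives [v A = - v]. *)
have contra c : v *m A = c *: v -> False.
  have v0 : v != 0 by apply: contraNneq vA => ->; rewrite mul0mx.
  move=> vc; have vE : v *m (A - a%:M) = (c - a) *: v.
    by rewrite mulmxBr vc mul_mx_scalar scalerBl.
  case/negP: vA; move: vAA; rewrite vE -scalemxAl vE scalerA => /eqP.
  by rewrite scaler_eq0 mulf_eq0 orbb -scaler_eq0.
have k_pos : k <> 0%N.
  by move=> /degree0_adjacency A0; apply: (contra 0); rewrite A0 mulmx0 scale0r.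
have k_max : k <> n.-1.
  move=> /degree_max_adjacency A1; apply: (contra (- 1)).
  by rewrite A1 mulmxBr vJ mulmx1 sub0r scaleN1r.
have k_lt : (k < n.-1)%N by have := degree_lt; lia.
have n1 : (0 < n.-1)%N by lia.
(* The value of [a] forced by the trace; now strictly between -1 and 0, it cannot be an integer. *)
pose q : rat := - (k%:R / n.-1%:R).
have aq : a = ratr q.
  rewrite rmorphN fmorph_div /= !ratr_nat; apply: (mulfI (_ : n.-1%:R != 0)).
    by rewrite pnatr_eq0 -lt0n.
  by rewrite tr mulrN mulrCA divff ?mulr1 // pnatr_eq0 -lt0n.
have AE : A = map_mx intr (\matrix_(i, j) (arc (ev i) (ev j))%:R : 'M[int]_n).
  by apply/matrixP => i j; rewrite !mxE; case: arc.
move: eigA; rewrite AE aq => /rational_eigenvalue_int /intrP[z qz].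
have q_gt : - 1 < q by rewrite ltrN2 ltr_pdivrMr ?ltr0n // mul1r ltr_nat.
have q_lt : q < 0 by rewrite oppr_lt0 divr_gt0 ?ltr0n // lt0n; apply/eqP.
by move: q_gt q_lt; rewrite qz -[-1](rmorphN1 (intr : int -> rat)) ltr_int ltrz0; lia.
Qed.

(** * From walk-regularity to an equation between eigenvalues *)

(** On row vectors killed by [J], the power [A ^ l] acts as [c A + d]. Eigenvectors for [a] and [b]
    give the values of [x ^ l - c x - d] there, and [v] gives its derivative at [a]. The result is
    kept homogeneous, as [a] may still be 0. *)
Lemma swr_tangent l a b (v : 'rV[R[i]]_n) :
    (0 < l)%N -> strongly_walk_regular G l -> a != k%:R ->
    v *m (A - a%:M) != 0 -> v *m (A - a%:M) *m (A - a%:M) = 0 ->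
    b != k%:R -> eigenvalue A b ->
  b ^+ l - l%:R * a ^+ l.-1 * b + l.-1%:R * a ^+ l = 0.
Proof.
case: l => // l _ /walk_regular_adjacency_matrixX[c [d [e Al]]] ak vA vAA bk.
case/eigenvalueP => x xA x0.
have mulAl (y : 'rV_n) : y *m J = 0 -> y *m A ^+ l.+1 = c *: (y *m A) + d *: y.
  move=> yJ; rewrite Al !mulmxDr -!scalemxAr yJ scaler0 addr0.
  by rewrite mul_mx_scalar.
have eigX z (y : 'rV_n) m : y *m A = z *: y -> y *m A ^+ m = z ^+ m *: y.
  move=> yA; elim: m => [|m IHm]; first by rewrite !expr0 mulmx1 scale1r.
  rewrite exprSr -[_ * _]/(_ *m _) mulmxA IHm -scalemxAl yA scalerA.
  by rewrite -exprSr.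
have bE : b ^+ l.+1 = c * b + d.
  have := mulAl x (eigenvector_orthogonal bk xA).
  rewrite (eigX b) // xA scalerA -scalerDl => /eqP.
  by rewrite -subr_eq0 -scalerBl scaler_eq0 (negPf x0) orbF subr_eq0 => /eqP.
pose w := v *m (A - a%:M).
have wA : w *m A = a *: w.
  by apply/eqP; rewrite -subr_eq0 -mul_mx_scalar -mulmxBr vAA.
have aE : a ^+ l.+1 = c * a + d.
  have := mulAl w (eigenvector_orthogonal ak wA).
  rewrite (eigX a) // wA scalerA -scalerDl => /eqP.
  by rewrite -subr_eq0 -scalerBl scaler_eq0 (negPf vA) orbF subr_eq0 => /eqP.
have vAE : v *m A = a *: v + w by rewrite /w mulmxBr mul_mx_scalar addrC subrK.
(* Powers of a Jordan block of size 2, in the basis [v], [w]. *)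
have vX m : v *m A ^+ m.+1 = a ^+ m.+1 *: v + (m.+1%:R * a ^+ m) *: w.
  elim: m => [|m IHm]; first by rewrite !expr1 expr0 mulr1 scale1r.
  rewrite exprSr -[_ * _]/(_ *m _) mulmxA IHm mulmxDl -!scalemxAl vAE wA.
  rewrite scalerDr !scalerA -addrA -scalerDl -exprSr; congr (_ + _ *: _).
  by rewrite -[m.+2]addn1 natrD exprS; ring.
have cE : l.+1%:R * a ^+ l = c.
  have := mulAl v (genvec_orthogonal ak vAA).
  rewrite vX vAE scalerDr scalerA addrAC -scalerDl -aE => /addrI/eqP.
  by rewrite -subr_eq0 -scalerBl scaler_eq0 (negPf vA) orbF subr_eq0 => /eqP.
rewrite /= bE cE; have -> : d = a ^+ l.+1 - c * a by rewrite aE; ring.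
by rewrite -cE exprS -[l.+1]addn1 natrD; ring.
Qed.

End Adjacency.

(** * Parity and uniqueness of the walk length *)

Theorem proposition6p3 (R : realType) (G : digraph)
  (Gconnected : strongly_connected G)
  (Gregular : regular G)
  (Greal : forall a : R[i],
     eigenvalue (adjacency_matrix R G) a -> a \is Num.real)
  (Gnondiag : ~ diagonalizable (adjacency_matrix R G)) :
  (exists s : seq nat, (size s <= 2)%N /\
     forall l : nat, (1 < l)%N -> strongly_walk_regular G l -> l \in s) /\
  (forall l : nat, (1 < l)%N -> strongly_walk_regular G l -> odd l).
Proof.
have [k Gk] := Gregular.
have [a [v [vA vAA]]] := nondiagonalizable_genvec Gnondiag.
have ak : a != k%:R.
  by apply: contraNneq vA => aE; rewrite aE in vAA *; apply/eqP/degree_genvec.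
have [b [eb ba bk]] := third_eigenvalue Gk Gconnected ak vA vAA.
have /Greal/complex_realP[y aE] : eigenvalue (adjacency_matrix R G) a.
  apply/eigenvalueP; exists (v *m (adjacency_matrix R G - a%:M)) => //.
  by apply/eqP; rewrite -subr_eq0 -mul_mx_scalar -mulmxBr vAA.
have /complex_realP[x bE] := Greal b eb.
have xy : x != y by apply: contraNneq ba => xy; rewrite bE aE xy.
have tangent l : (1 < l)%N -> strongly_walk_regular G l ->
    y != 0 /\ tangent_poly (x / y) l.-1 = 0.
  move=> l1 /(swr_tangent Gk (ltnW l1))/(_ ak vA vAA bk eb).
  case: l l1 => [|[|l]] // _; rewrite aE bE /=.
  rewrite -!rmorphXn -!(rmorph_nat (real_complex R)) -!rmorphM -rmorphB -rmorphD.
  rewrite -[RHS](rmorph0 (real_complex R)) => /fmorph_inj E.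
  (* If [a = 0], the homogeneous equation reduces to a vanishing power of [b], so [b = a]; the
     exponent of [a] in the middle term is positive because the length exceeds 1. *)
  have y0 : y != 0.
    apply: contra_neq xy => y0; move/eqP: E.
    by rewrite y0 !expr0n /= !(mulr0, mul0r, subr0, addr0) expf_eq0 => /eqP.
  split=> //; rewrite /tangent_poly; apply: (mulIf (expf_neq0 l.+2 y0)).
  rewrite mul0r -{}[RHS]E expr_div_n.
  rewrite mulrDl mulrBl divfK ?expf_neq0 //; congr (_ - _ + _).
  by rewrite exprS; field.
have s1 : y != 0 -> x / y != 1.
  by move=> y0; apply: contra_neq xy => /(canRL (divfK y0)); rewrite mul1r.
split; last first.
  case=> [|l] // l1 swl; have [y0 rl] := tangent _ l1 swl.
  by have [_] := tangent_poly_root (s1 y0) l1 rl.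
(* The ratio [x / y] does not depend on the length, so any two admissible lengths coincide and a
   list of at most one element suffices. *)
have [[l [l1 swl]]|none] := boolp.pselect (exists l, (1 < l)%N /\ strongly_walk_regular G l).
  exists [:: l]; split=> // m m1 swm; rewrite inE.
  have [y0 rl] := tangent l l1 swl; have [_ rm] := tangent m m1 swm.
  have := tangent_poly_root_uniq (s1 y0) _ _ rl rm; lia.
by exists [::]; split=> // l l1 swl; case: none; exists l.
Qed.
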